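(* Let $(\mathbb S,\mathbb A,p,r)$ be a Markov decision process, $\mathbb G\subset\mathbb S$ a goal set, and $d_{\mathbb G}(s):=\inf_{s'\in\mathbb G}\|s-s'\|$. Consider the problem of maximizing $V^{\pi}(s)=\mathbb E_{A\sim\pi}\big[\sum_{t=0}^\infty\gamma^t r(S_t,A_t)\mid S_0=s\big]$ over policies $\pi\in\Pi$, with $\gamma\in(0,1]$. Let $\eta\in[0,1)$ and let $\pi_0$ be a policy with the goal reaching property $$\forall s_0\in\mathbb S\quad \mathbb P\big[d_{\mathbb G}(S^{\pi_0}_t(s_0))\xrightarrow{t\to\infty}0\big]\ge 1-\eta .$$ Let $\pi_t$, $t\ge0$, be produced by Algorithm 1 (described in the context) with this $\pi_0$. Then the same goal reaching property holds under $\pi_t$, i.e. $$\forall s_0\in\mathbb S\quad \mathbb P\big[d_{\mathbb G}(S^{\pi_t}_t(s_0))\xrightarrow{t\to\infty}0\big]\ge 1-\eta .$$ Here ''$d_{\mathbb G}(S_t)\xrightarrow{t\to\infty}0$'' means that $0$ is a limit point of the sequence $d_{\mathbb G}(S_t)$, i.e. $\liminf_{t\to\infty}d_{\mathbb G}(S_t)=0$.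
   Context: MDP. $\mathbb S$ is a finite-dimensional Banach space (state space), $\mathbb A$ is a compact topological space (action space), $p(\bullet\mid s,a)$ is the transition probability density of the next state given state $s$ and action $a$, and $r:\mathbb S\times\mathbb A\to\mathbb R$ is the reward function. $(\Omega,\Sigma,\mathbb P)$ is the underlying probability space. $\Pi$ is the set of admissible policies; a policy $\pi$ gives a distribution $\pi(\bullet\mid s)$ on actions for each state $s$. The goal $\mathbb G\subset\mathbb S$ is a compact neighborhood of the origin. Trajectories. $S^{\pi}_t(s_0)$ is the state trajectory from $s_0$ under $\pi$: $S^\pi_0(s_0)=s_0$, and for $t>0$, $S^\pi_t(s_0)\sim p(\bullet\mid S^\pi_{t-1}(s_0),A_{t-1})$ with $A_{t-1}\sim\pi(\bullet\mid S^\pi_{t-1}(s_0))$. $S^{\pi_t}_t(s_0)$ is the trajectory when at each time $t$ the action is drawn from the policy $\pi_t$ generated by Algorithm 1. Algorithm 1. Data: a compact weight set $\mathbb W$; a critic model, i.e. a family of functions $\hat V^w:\mathbb S\to\mathbb R$, $w\in\mathbb W$; an arbitrary critic loss $\mathcal L_{\rm crit}$ and an arbitrary actor loss $\mathcal L_{\rm act}$ (which may depend on past data); a number $\bar\nu>0$; functions $\hat\kappa_{\rm low},\hat\kappa_{\rm up}:\mathbb R_{\ge0}\to\mathbb R_{\ge0}$ that are zero at zero, monotonically increasing and tending to infinity; the policy $\pi_0$; a relaxation factor $\lambda_{\rm relax}\in[0,1)$. Initialization: initial state $s_0$ and $w_0\in\mathbb W$ with $-\hat\kappa_{\rm up}(\|s_0\|)\le\hat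 V^{w_0}(s_0)\le-\hat\kappa_{\rm low}(\|s_0\|)$. Set $w^\dagger\leftarrow w_0$, $s^\dagger\leftarrow s_0$, $P_{\rm relax}\leftarrow\lambda_{\rm relax}$. For $t=1,2,\dots$: (1) Take an action sampled from $\pi_{t-1}(\bullet\mid s_{t-1})$ (for $t=1$ this is the given policy $\pi_0$) and get the state $s_t$. (2) Try a critic update: look for $w^*\in\arg\min_{w\in\mathbb W}\mathcal L_{\rm crit}(w)$ subject to $\hat V^w(s_t)-\hat V^{w^\dagger}(s^\dagger)\ge\bar\nu$ and $-\hat\kappa_{\rm up}(\|s_t\|)\le\hat V^w(s_t)\le-\hat\kappa_{\rm low}(\|s_t\|)$. The attempt may succeed or fail; a found $w^*$ satisfies the constraints. (3) If a solution $w^*$ was found, set $s^\dagger\leftarrow s_t$, $w^\dagger\leftarrow w^*$. (4) Sample $q$ uniformly from $[0,1]$ (freshly at each step). (5) If a solution $w^*$ was found or $q<P_{\rm relax}$, set $\pi_t(\bullet\mid s_t)\leftarrow\arg\min_{\pi\in\Pi}\mathcal L_{\rm act}(\pi)$ (optionally modified to produce a random action with some probability $\varepsilon>0$); otherwise set $\pi_t(\bullet\mid s_t)\leftarrow\pi_0(\bullet\mid s_t)$. (6) Set $P_{\rm relax}\leftarrow\lambda_{\rm relax}P_{\rm relax}$. *)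

(* Defs.v *)
(* MathComp / MathComp-Analysis *)
From HB Require Import structures.
From mathcomp Require Import all_boot all_order all_algebra.
From mathcomp Require Import all_classical all_reals all_analysis.
From mathcomp Require Import measurable_realfun.

Set Implicit Arguments.
Unset Strict Implicit.
Unset Printing Implicit Defensive.

Import Order.TTheory GRing.Theory Num.Theory.
Import numFieldNormedType.Exports.

Local Open Scope classical_set_scope.
Local Open Scope ring_scope.

Definition finite_dimensional (R : realType) (S : completeNormedModType R) :
    Prop :=
  exists (n : nat) (e : 'I_n -> S),
    forall x : S, exists c : 'I_n -> R, x = \sum_(i < n) c i *: e i.

(* The space T itself, carrying its Borel sigma-algebra. *)
Notation borel T := (g_sigma_algebraType (@open T)).

Definition policy (R : realType) (S : completeNormedModType R)
    (A : ptopologicalType) : Type :=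
  R.-pker borel S ~> borel A.

(* Next-state densities are taken with respect to a sigma-finite reference
   measure on the state space (Lebesgue measure being the usual choice).  The
   reward enters only the objective E[\sum_t gamma^t r(S_t, A_t)], which goal
   reaching does not involve. *)
Record mdp (R : realType) (S : completeNormedModType R)
    (A : ptopologicalType) : Type := Mdp {
  refm : {sigma_finite_measure set (borel S) -> \bar R} ;
  density : (borel S * borel A)%type -> borel S -> R ;
  reward : S -> A -> R ;
  density_ge0 : forall sa s', 0 <= density sa s' ;
  measurable_density :
    measurable_fun setT
      (fun u : ((borel S * borel A) * borel S)%type => density u.1 u.2) ;
  density_total : forall sa,
    (\int[refm]_(s' in setT) (density sa s')%:E = 1)%E
}.

Definition transition (R : realType) (S : completeNormedModType R)
    (A : ptopologicalType) (M : mdp S A) (sa : (borel S * borel A)%type)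
    (B : set (borel S)) : \bar R :=
  (\int[refm M]_(s' in B) (density M sa s')%:E)%E.

Definition is_sub_sigma_algebra (d : measure_display) (Omega : measurableType d)
    (F : set (set Omega)) : Prop :=
  sigma_algebra setT F /\ F `<=` measurable.

Definition adapted (d d' : measure_display) (Omega : measurableType d)
    (T : measurableType d') (F : set (set Omega)) (f : Omega -> T) : Prop :=
  forall B : set T, measurable B -> F (f @^-1` B).

(* [k] is the conditional distribution of Y given the information F. *)
Definition cond_law (d d' : measure_display) (Omega : measurableType d)
    (T : measurableType d') (R : realType) (P : probability Omega R)
    (F : set (set Omega)) (Y : Omega -> T) (k : Omega -> set T -> \bar R) :
    Prop :=
  forall (E : set Omega) (B : set T), F E -> measurable B ->
    (P (E `&` Y @^-1` B) = \int[P]_(w in E) k w B)%E.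

(* X, U are the states and actions when the action at time t is drawn from
   pol t w, a policy that may depend on the outcome w through the past.
   F t is the information available just before the action U t is drawn,
   Fa t the information just after. *)
Record controlled_trajectory (d : measure_display) (Omega : measurableType d)
    (R : realType) (P : probability Omega R) (S : completeNormedModType R)
    (A : ptopologicalType) (M : mdp S A) (pol : nat -> Omega -> policy S A)
    (s0 : S) (X : nat -> Omega -> borel S) (U : nat -> Omega -> borel A)
    (F Fa : nat -> set (set Omega)) : Prop := ControlledTrajectory {
  traj_sigmaF : forall t, is_sub_sigma_algebra (F t) ;
  traj_sigmaFa : forall t, is_sub_sigma_algebra (Fa t) ;
  traj_F_Fa : forall t, F t `<=` Fa t ;
  traj_Fa_F : forall t, Fa t `<=` F t.+1 ;
  traj_init : forall w, X 0%N w = s0 ;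
  traj_state : forall t, adapted (F t) (X t) ;
  traj_action : forall t, adapted (Fa t) (U t) ;
  traj_policy : forall t B, measurable B ->
    adapted (F t) (fun w => pol t w (X t w) B) ;
  traj_action_law : forall t,
    cond_law P (F t) (U t) (fun w B => pol t w (X t w) B) ;
  traj_state_law : forall t,
    cond_law P (Fa t) (X t.+1) (fun w B => transition M (X t w, U t w) B)
}.

Definition trajectory (d : measure_display) (Omega : measurableType d)
    (R : realType) (P : probability Omega R) (S : completeNormedModType R)
    (A : ptopologicalType) (M : mdp S A) (pi : policy S A) (s0 : S)
    (X : nat -> Omega -> borel S) : Prop :=
  exists (U : nat -> Omega -> borel A) (F Fa : nat -> set (set Omega)),
    controlled_trajectory P M (fun _ _ => pi) s0 X U F Fa.

Definition goal_dist (R : realType) (S : completeNormedModType R)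
    (G : set S) (s : S) : R :=
  inf [set `|s - s'| | s' in G].

(* The lower limit is taken in \bar R: for real sequences diverging to +oo,
   real-valued limits default to a junk value. *)
Definition goal_reached (R : realType) (S : completeNormedModType R)
    (G : set S) (x : nat -> S) : Prop :=
  limn_einf (fun t => (goal_dist G (x t))%:E) = 0%E.

Definition goal_reaching (d : measure_display) (Omega : measurableType d)
    (R : realType) (P : probability Omega R) (S : completeNormedModType R)
    (G : set S) (eta : R) (X : nat -> Omega -> borel S) : Prop :=
  ((1 - eta)%:E <= P [set w | goal_reached G (fun t => X t w)])%E.

(* Only the values on the nonnegative reals matter. *)
Definition comparison_function (R : realType) (k : R -> R) : Prop :=
  [/\ k 0 = 0,
      forall x y, 0 <= x -> x <= y -> k x <= k y &
      k x @[x --> +oo] --> +oo].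

Definition is_argmin (R : realType) (T : Type) (D : set T) (f : T -> R)
    (x : T) : Prop :=
  D x /\ forall y, D y -> f x <= f y.

(* The losses at iteration t may depend on the outcome w, hence on all past
   data.  [explore] is the distribution of the random action taken with
   probability [eps t]; the unmodified algorithm has [eps t = 0].  No continuity
   or measurability in the weights is required of the critic or the losses. *)
Record agent (d : measure_display) (Omega : measurableType d) (R : realType)
    (S : completeNormedModType R) (A : ptopologicalType)
    (W : topologicalType) : Type := Agent {
  weights : set W ;
  critic : W -> S -> R ;
  critic_loss : nat -> Omega -> W -> R ;
  actor_loss : nat -> Omega -> policy S A -> R ;
  nu_bar : R ;
  kappa_low : R -> R ;
  kappa_up : R -> R ;
  lambda_relax : R ;
  eps : nat -> R ;
  explore : policy S A ;
  weights_compact : compact weights ;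
  nu_bar_gt0 : 0 < nu_bar ;
  kappa_lowP : comparison_function kappa_low ;
  kappa_upP : comparison_function kappa_up ;
  lambda_relax_itv : 0 <= lambda_relax < 1 ;
  eps_itv : forall t, 0 <= eps t <= 1
}.

Definition critic_envelope (d : measure_display) (Omega : measurableType d)
    (R : realType) (S : completeNormedModType R) (A : ptopologicalType)
    (W : topologicalType) (D : agent Omega S A W) (w : W) (s : S) : Prop :=
  - kappa_up D `|s| <= critic D w s <= - kappa_low D `|s|.

Definition critic_feasible (d : measure_display) (Omega : measurableType d)
    (R : realType) (S : completeNormedModType R) (A : ptopologicalType)
    (W : topologicalType) (D : agent Omega S A W) (wd : W) (sd s : S) : set W :=
  [set w | [/\ weights D w,
               nu_bar D <= critic D w s - critic D wd sd &
               critic_envelope D w s]].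

(* Iteration t.+1 for the outcome o, the new state being s; [wstar] is the
   result of the critic update, None meaning that the attempt failed. *)
Definition critic_step (d : measure_display) (Omega : measurableType d)
    (R : realType) (S : completeNormedModType R) (A : ptopologicalType)
    (W : topologicalType) (D : agent Omega S A W) (t : nat) (o : Omega)
    (s : S) (wstar : option W) (wd : W) (sd : S) (wd' : W) (sd' : S) : Prop :=
  match wstar with
  | Some w => [/\ is_argmin (critic_feasible D wd sd s)
                            (critic_loss D t.+1 o) w, wd' = w & sd' = s]
  | None => wd' = wd /\ sd' = sd
  end.

(* P_relax equals lambda_relax ^+ t.+1 during iteration t.+1.  The law [pi] is
   the updated pi_{t+1}(. | s). *)
Definition actor_step (d : measure_display) (Omega : measurableType d)
    (R : realType) (S : completeNormedModType R) (A : ptopologicalType)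
    (W : topologicalType) (D : agent Omega S A W) (Pi : set (policy S A))
    (pi0 : policy S A) (t : nat) (o : Omega) (s : S) (found : bool) (q : R)
    (pi : set (borel A) -> \bar R) : Prop :=
  if found || (q < lambda_relax D ^+ t.+1) then
    exists pistar : policy S A,
      is_argmin Pi (actor_loss D t.+1 o) pistar /\
      forall B, measurable B ->
        (pi B = (1 - eps D t.+1)%:E * pistar s B
                + (eps D t.+1)%:E * explore D s B)%E
  else forall B, measurable B -> pi B = pi0 s B.

(* X is a state trajectory produced by the algorithm started at s0 with the
   initial weight w0.  Fc t.+1 is the information available after the critic
   update of iteration t.+1 and before q t.+1 is sampled: the last [cond_law]
   says that q t.+1 is uniform on [0, 1] and independent of it. *)
Definition algorithm_run (d : measure_display) (Omega : measurableType d)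
    (R : realType) (P : probability Omega R) (S : completeNormedModType R)
    (A : ptopologicalType) (W : topologicalType) (M : mdp S A)
    (Pi : set (policy S A)) (pi0 : policy S A) (D : agent Omega S A W)
    (s0 : S) (w0 : W) (X : nat -> Omega -> borel S) : Prop :=
  exists (pol : nat -> Omega -> policy S A) (U : nat -> Omega -> borel A)
    (F Fa Fc : nat -> set (set Omega)) (wstar : nat -> Omega -> option W)
    (wdag : nat -> Omega -> W) (sdag : nat -> Omega -> S)
    (q : nat -> Omega -> R),
    controlled_trajectory P M pol s0 X U F Fa /\
    [/\ weights D w0, critic_envelope D w0 s0 &
        forall o, [/\ wdag 0%N o = w0, sdag 0%N o = s0 & pol 0%N o = pi0]] /\
    forall t,
      [/\ is_sub_sigma_algebra (Fc t.+1), Fa t `<=` Fc t.+1 & Fc t.+1 `<=` F t.+1]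
      /\
      [/\ adapted (Fc t.+1) (X t.+1),
          Fc t.+1 [set o | isSome (wstar t.+1 o)],
          adapted (F t.+1) (q t.+1) &
          cond_law P (Fc t.+1) (q t.+1) (fun _ => uniform_prob (@ltr01 R))]
      /\
      forall o,
        critic_step D t o (X t.+1 o) (wstar t.+1 o)
          (wdag t o) (sdag t o) (wdag t.+1 o) (sdag t.+1 o)
        /\
        actor_step D Pi pi0 t o (X t.+1 o) (isSome (wstar t.+1 o)) (q t.+1 o)
          (pol t.+1 o (X t.+1 o)).

(* Main.v *)
(* Every critic update raises the value of the stored pair by at least nu_bar,
   and these values are bounded above by 0, so there are finitely many updates;
   since the sum of the lambda_relax ^+ t is finite, Borel-Cantelli shows that
   almost surely q_t < P_relax happens finitely often.  Hence almost surely the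
   actions are drawn from pi_0 from some random time on.  That time is not a
   stopping time, but conditioning on it is not needed: let D_j be the event
   that from time j on there is no update, q_t >= P_relax and the distance to
   the goal is at least 1/(j+1).  By the Markov property at the fixed time j,
   P(D_j) is at most the integral over X_j of the probability that the
   pi_0-trajectory started there stays at distance at least 1/(j+1), which is at
   most eta.  The D_j increase, and up to a null set their union is the event
   that the goal is missed.

   Kernels are maps into [giry], i.e. into subprobability measures, so that a
   kernel restricted to an event is again a kernel. *)
Require Import Defs.
From HB Require Import structures.
From mathcomp Require Import all_boot all_order all_algebra.
From mathcomp Require Import all_classical all_reals all_analysis.
From mathcomp Require Import measurable_realfun giry.

Set Implicit Arguments.
Unset Strict Implicit.
Unset Printing Implicit Defensive.

Import Order.TTheory GRing.Theory Num.Theory.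
Import numFieldNormedType.Exports.

Local Open Scope classical_set_scope.
Local Open Scope ring_scope.

(** * Integrals against conditional laws *)

Section cond_giry.
Context d d' (Omega : measurableType d) (T : measurableType d') (R : realType).
Local Open Scope ereal_scope.

Definition giry_restrict (E : set Omega) (f : Omega -> giry T R) (w : Omega) :
  giry T R := if w \in E then f w else mzero.

Lemma measurable_giry_restrict E f : measurable E ->
  measurable_fun setT f -> measurable_fun setT (giry_restrict E f).
Proof.
move=> mE mf; apply: measurable_fun_ifT => //.
apply: (measurable_fun_bool true).
by rewrite setTI preimage_true set_mem_set.
Qed.

Lemma giry_int_restrict E f h :
  (fun w => giry_int (giry_restrict E f w) h) =
  (fun w => giry_int (f w) h) \_ E.
Proof.
apply/funext => w; rewrite /giry_restrict patchE; case: ifPn => // _.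
exact: integral_measure_zero.
Qed.

Variable (P : probability Omega R).
(** The two sides are integrals of [h] against two measures: the law of [Y] on [E], and the mixture
    of the [k w] over [E]. These are finite and agree on the pi-system [G], hence on the
    sigma-algebra it generates. *)
Lemma cond_giry_integral (G : set (set T)) (E : set Omega) (Y : Omega -> T)
    (k : Omega -> giry T R) :
  measurable = <<s G >> -> setI_closed G -> G setT ->
  measurable E -> measurable_fun setT Y -> measurable_fun setT k ->
  (forall B, G B -> P (E `&` Y @^-1` B) = \int[P]_(w in E) k w B) ->
  forall h, measurable_fun setT h -> (forall x, 0 <= h x) ->
  \int[P]_(w in E) h (Y w) = \int[P]_(w in E) giry_int (k w) h.
Proof.
move=> mG GI GT mE mY mk kP h mh h0.
have mr : measurable_fun setT (giry_restrict E (giry_ret (R := R) \o Y)).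
  apply: measurable_giry_restrict => //.
  apply: measurableT_comp => //; exact: measurable_giry_ret.
have mr' := measurable_giry_restrict mE mk.
pose m1 := giry_bind (P : giry _ R) mr.
pose m2 := giry_bind (P : giry _ R) mr'.
have m1E f : measurable_fun setT f -> (forall x, 0 <= f x) ->
    giry_int m1 f = \int[P]_(w in E) f (Y w).
  move=> mf f0; rewrite giry_int_bind// giry_int_restrict
    /giry_int -integral_mkcond.
  by apply: eq_integral => w _; exact: giry_int_ret.
have m2E f : measurable_fun setT f -> (forall x, 0 <= f x) ->
    giry_int m2 f = \int[P]_(w in E) giry_int (k w) f.
  by move=> mf f0; rewrite giry_int_bind// giry_int_restrict
    /giry_int -integral_mkcond.
rewrite -m1E// -m2E//; apply: eq_measure_integral => A mA _.
apply: (measure_unique G (fun=> setT)) => //.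
- by rewrite bigcup_const//; exists 0%N.
- move=> B GB.
  have mB : measurable B by rewrite mG; exact: sub_sigma_algebra.
  rewrite -[LHS]/(m1 B) -[RHS]/(m2 B).
  rewrite -(setIT B) -!integral_indic//.
  have mi : measurable_fun setT (fun x : T => (\1_B x)%:E : \bar R).
    exact/measurable_EFinP/measurable_indic.
  rewrite -[LHS]/(giry_int m1 _) -[RHS]/(giry_int m2 _) m1E// m2E//.
  have mYB : measurable (Y @^-1` B) by rewrite -(setTI (_ @^-1` _)); exact: mY.
  transitivity (\int[P]_(w in E) (\1_(Y @^-1` B) w)%:E) => //.
  transitivity (P (E `&` Y @^-1` B)); first by rewrite integral_indic// setIC.
  rewrite kP//; apply: eq_integral => w _.
  by rewrite /giry_int integral_indic// setIT.
- by move=> _; exact: le_lt_trans (sprobability_setT (s := m1)) (ltry _).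
Qed.

End cond_giry.

(** Exhibits [F] as the measurable sets of a measurable type, which transfers the closure properties
    of sigma-algebras. *)
Lemma sub_sigma_algebraE d (Omega : measurableType d) (F : set (set Omega)) :
  is_sub_sigma_algebra F -> F = @measurable _ (g_sigma_algebraType F).
Proof. by move=> [sF _]; rewrite -[LHS](sigma_algebra_id sF). Qed.

Section sub_sigma_algebra_closure.
Context d (Omega : measurableType d) (F : set (set Omega)).
Hypothesis sF : is_sub_sigma_algebra F.

Lemma sub_sigma_algebraI E1 E2 : F E1 -> F E2 -> F (E1 `&` E2).
Proof. by rewrite (sub_sigma_algebraE sF); exact: measurableI. Qed.

Lemma sub_sigma_algebraC E : F E -> F (~` E).
Proof. by rewrite (sub_sigma_algebraE sF); exact: measurableC. Qed.

Lemma sub_sigma_algebraT : F setT.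
Proof. by rewrite (sub_sigma_algebraE sF); exact: measurableT. Qed.

Lemma adapted_measurable d' (T : measurableType d') (f : Omega -> T) :
  adapted F f -> measurable_fun setT f.
Proof. by move=> aF _ B mB; rewrite setTI; apply: (sF.2); exact: aF. Qed.

End sub_sigma_algebra_closure.

(** * The one-step kernel of a fixed policy *)

Section transition_giry.
Context (R : realType) (S : completeNormedModType R) (A : ptopologicalType).
Variable M : mdp S A.
Local Open Scope ereal_scope.

Section measure.
Variable sa : (borel S * borel A)%type.

Let measurable_densityr :
  measurable_fun [set: borel S] (fun s' => (density M sa s')%:E).
Proof.
apply/measurable_EFinP.
exact: (measurableT_comp (measurable_density M) (pair1_measurable sa)).
Qed.

Let transition0 : transition M sa set0 = 0.
Proof. exact: integral_set0. Qed.

Let transition_ge0 B : 0 <= transition M sa B.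
Proof. by apply: integral_ge0 => s _; rewrite lee_fin density_ge0. Qed.

Let transition_sigma_additive : semi_sigma_additive (transition M sa).
Proof.
apply: semi_sigma_additive_nng_induced => // s.
by rewrite lee_fin density_ge0.
Qed.

HB.instance Definition _ := isMeasure.Build _ _ _ (transition M sa)
  transition0 transition_ge0 transition_sigma_additive.

Let transition_setT : transition M sa setT <= 1.
Proof. by rewrite /transition density_total. Qed.

HB.instance Definition _ := Measure_isSubProbability.Build _ _ _
  (transition M sa) transition_setT.

Definition transition_giry : giry (borel S) R := transition M sa.

End measure.

(** Measurability into [giry] is tested on measurable sets [B], where it is Tonelli: the jointly
    measurable density times the indicator of [B] is integrated over the next state. *)
Lemma measurable_transition_giry : measurable_fun setT transition_giry.
Proof.
apply: measurable_giry_codensity => //= B mB.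
rewrite /transition; under eq_fun do rewrite integral_mkcond.
pose f (u : ((borel S * borel A) * borel S)%type) : \bar R :=
  (density M u.1 u.2)%:E * (\1_B u.2)%:E.
apply: (eq_measurable_fun (fubini_F (refm M) f)).
  move=> sa _; rewrite /fubini_F; apply: eq_integral => s _.
  by rewrite /f /= epatch_indic.
apply: measurable_fun_fubini_tonelli_F.
- apply: emeasurable_funM.
    by apply/measurable_EFinP; exact: measurable_density.
  apply/measurable_EFinP.
  by apply: measurableT_comp => //; exact: measurable_indic.
- by move=> u; rewrite /f -EFinM lee_fin mulr_ge0// density_ge0.
Qed.

Variable pi : policy S A.

Section joint.
Variable s : borel S.

Let action_law : set (borel A) -> \bar R := pi s.

HB.instance Definition _ := isMeasure.Build _ _ _ action_law
  (measure0 (pi s)) (measure_ge0 (pi s))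
  (@measure_semi_sigma_additive _ _ _ (pi s)).

Let action_law_setT : action_law setT <= 1.
Proof. by rewrite /action_law prob_kernel. Qed.

HB.instance Definition _ :=
  Measure_isSubProbability.Build _ _ _ action_law action_law_setT.

(** Joint law of state and action: the Dirac mass at [s] times the action law [pi s]. *)
Definition joint_giry : giry (borel S * borel A)%type R :=
  giry_map (pair1_measurable s) (action_law : giry (borel A) R).

End joint.

Lemma joint_giryE s C : joint_giry s C = pi s (xsection C s).
Proof. by rewrite xsectionE. Qed.

Lemma measurable_joint_giry : measurable_fun setT joint_giry.
Proof.
apply: measurable_giry_codensity => // C mC.
under eq_fun do rewrite joint_giryE.
by apply: measurable_fun_xsection_finite_kernel; rewrite inE.
Qed.

(** Averaging the transition over the action leaves the Markov kernel of the state chain under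
    [pi]. *)
Definition step_giry (s : borel S) : giry (borel S) R :=
  giry_bind (joint_giry s) measurable_transition_giry.

Lemma measurable_step_giry : measurable_fun setT step_giry.
Proof.
apply: (measurableT_comp (measurable_giry_bind measurable_transition_giry)).
exact: measurable_joint_giry.
Qed.

Lemma step_giryE s B : measurable B ->
  step_giry s B = giry_int (joint_giry s) (fun sa => transition M sa B).
Proof.
by move=> mB; apply: giry_int_map => //; exact: measurable_giry_ev.
Qed.

End transition_giry.

(** * The one-step Markov property *)

Section one_step.
Context d (Omega : measurableType d) (R : realType) (P : probability Omega R)
  (S : completeNormedModType R) (A : ptopologicalType) (M : mdp S A)
  (pol : nat -> Omega -> policy S A) (s0 : S)
  (X : nat -> Omega -> borel S) (U : nat -> Omega -> borel A)
  (F Fa : nat -> set (set Omega)) (pi : policy S A).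
Hypothesis XU : controlled_trajectory P M pol s0 X U F Fa.
Local Open Scope ereal_scope.

(** Two conditionings in succession: given [Fa t] the next state has law [transition], and on [E],
    given [F t], the pair of state and action has law [joint_giry]. The latter is checked on
    rectangles, a pi-system generating the product sigma-algebra. *)
Lemma trajectory_step t E : F t E ->
  (forall w, E w -> forall B, measurable B ->
    pol t w (X t w) B = pi (X t w) B) ->
  forall B, measurable B ->
  P (E `&` X t.+1 @^-1` B) = \int[P]_(w in E) step_giry M pi (X t w) B.
Proof.
move=> FE polE B mB.
have sF := traj_sigmaF XU t.
have mE : measurable E by apply: sF.2.
have mX : measurable_fun setT (X t).
  exact (adapted_measurable sF (traj_state XU t)).
have mU : measurable_fun setT (U t).
  exact (adapted_measurable (traj_sigmaFa XU t) (traj_action XU t)).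
rewrite (traj_state_law XU)//; last exact: traj_F_Fa XU t _ FE.
under [RHS]eq_integral do rewrite step_giryE//.
have mtr : measurable_fun setT (fun sa => transition M sa B).
  apply: (measurableT_comp (measurable_giry_ev mB)).
  exact: measurable_transition_giry.
apply: (@cond_giry_integral _ _ _ _ _ P
  [set B1 `*` B2 | B1 in measurable & B2 in measurable] E
  (fun w => (X t w, U t w)) (fun w => joint_giry pi (X t w))) => //.
- exact: measurable_prod_measurableType.
- move=> _ _ [B1 mB1 [B2 mB2 <-]] [B3 mB3 [B4 mB4 <-]].
  exists (B1 `&` B3); first exact: measurableI.
  by exists (B2 `&` B4); [exact: measurableI|rewrite setXI].
- by exists setT => //; exists setT => //; rewrite setXTT.
- exact: measurable_fun_pair.
- apply: measurableT_comp => //; exact: measurable_joint_giry.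
move=> _ [B1 mB1 [B2 mB2 <-]].
(* Whether [X t] lies in [B1] is known at time [t], so this event joins the conditioning event and
   only the law of [U t] remains. *)
have FE1 : F t (E `&` X t @^-1` B1).
  by apply: sub_sigma_algebraI => //; exact: traj_state XU t _ mB1.
transitivity (P (E `&` X t @^-1` B1 `&` U t @^-1` B2)).
  by congr (P _); rewrite -setIA.
rewrite (traj_action_law XU)// integral_mkcondr.
apply: eq_integral => w /set_mem Ew.
rewrite joint_giryE patchE; case: ifPn => [/set_mem XB1|XB1].
  by rewrite in_xsectionX ?inE// polE.
rewrite notin_xsectionX ?measure0//; apply: contra XB1.
Qed.

Lemma trajectory_step_integral t E : F t E ->
  (forall w, E w -> forall B, measurable B ->
    pol t w (X t w) B = pi (X t w) B) ->
  forall h, measurable_fun setT h -> (forall s, 0 <= h s) ->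
  \int[P]_(w in E) h (X t.+1 w) =
  \int[P]_(w in E) giry_int (step_giry M pi (X t w)) h.
Proof.
move=> FE polE; have sF := traj_sigmaF XU.
apply: (@cond_giry_integral _ _ _ _ _ P measurable E (X t.+1)
  (fun w => step_giry M pi (X t w))) => //.
- by rewrite sigma_algebra_id//; exact: sigma_algebra_measurable.
- by move=> B1 B2; exact: measurableI.
- exact ((sF t).2 _ FE).
- exact (adapted_measurable (sF t.+1) (traj_state XU t.+1)).
- apply: measurableT_comp; first exact: measurable_step_giry.
  exact (adapted_measurable (sF t) (traj_state XU t)).
- exact: trajectory_step.
Qed.

End one_step.

(** * Probability of remaining in a set *)

Section stay.
Context d (T : measurableType d) (R : realType).
Variables (K : T -> giry T R) (B : set T).
Hypotheses (mK : measurable_fun setT K) (mB : measurable B).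
Local Open Scope ereal_scope.

(* Probability that a Markov chain with kernel [K] started at [s] is in [B] at
   the times 0, ..., m. *)
Fixpoint stay (m : nat) (s : T) : \bar R :=
  if m is m'.+1 then (\1_B s)%:E * giry_int (K s) (stay m') else (\1_B s)%:E.

Lemma stay_ge0 m s : 0 <= stay m s.
Proof.
elim: m s => [|m IH] s /=; first by rewrite lee_fin.
by apply: mule_ge0; [rewrite lee_fin|exact: integral_ge0].
Qed.

Lemma measurable_stay m : measurable_fun setT (stay m).
Proof.
have mi : measurable_fun setT (fun s : T => (\1_B s)%:E : \bar R).
  exact/measurable_EFinP/measurable_indic.
elim: m => [|m IH] //=; apply: emeasurable_funM => //.
by apply: (measurableT_comp (measurable_giry_int IH (stay_ge0 m))).
Qed.

Lemma stay_le1 m s : stay m s <= 1.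
Proof.
elim: m s => [|m IH] s /=; first by rewrite lee_fin indicE; case: (_ \in _).
have h1 : giry_int (K s) (stay m) <= 1.
  rewrite (@le_trans _ _ (\int[K s]_x cst 1 x))//.
    apply: ge0_le_integral => //.
    - by move=> x _; exact: stay_ge0.
    - exact: measurable_stay.
  by rewrite integral_cst// mul1e sprobability_setT.
rewrite indicE; case: (_ \in _); last by rewrite mul0e.
by rewrite mul1e.
Qed.

End stay.

(** * Paths that remain in a set while following [pi] *)

Section path_probability.
Context d (Omega : measurableType d) (R : realType) (P : probability Omega R)
  (S : completeNormedModType R) (A : ptopologicalType) (M : mdp S A)
  (pol : nat -> Omega -> policy S A) (s0 : S)
  (X : nat -> Omega -> borel S) (U : nat -> Omega -> borel A)
  (F Fa : nat -> set (set Omega)) (pi : policy S A).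
Hypothesis XU : controlled_trajectory P M pol s0 X U F Fa.
Variable N : nat -> set Omega.
Hypothesis FN : forall t, F t (N t).
Hypothesis polN : forall t w, N t w -> forall B, measurable B ->
  pol t w (X t w) B = pi (X t w) B.
Variable B : set (borel S).
Hypothesis mB : measurable B.
Local Open Scope ereal_scope.

(** The range for [N] is one shorter: the action at time [t + m] does not affect the states up to
    that time. *)
Definition path_event (t m : nat) : set Omega :=
  [set w | (forall i, (i <= m)%N -> B (X (t + i)%N w)) /\
           (forall i, (i < m)%N -> N (t + i)%N w)].

Lemma path_event0 t : path_event t 0 = X t @^-1` B.
Proof.
apply/seteqP; split => w; first by move=> [/(_ 0%N (leqnn _))]; rewrite addn0.
by move=> Bw; split => // i; rewrite leqn0 => /eqP ->; rewrite addn0.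
Qed.

Lemma path_eventS t m :
  path_event t m.+1 = (X t @^-1` B `&` N t) `&` path_event t.+1 m.
Proof.
apply/seteqP; split => w.
  move=> [Bw Nw]; split.
    by split; [have := Bw 0%N|have := Nw 0%N]; rewrite addn0; apply.
  by split => i im; rewrite addSnnS; [exact: Bw|exact: Nw].
move=> [[B0 N0] [Bw Nw]]; split => -[|i] im; rewrite ?addn0// -addSnnS.
  exact: Bw.
exact: Nw.
Qed.

Lemma measurable_path_event t m : measurable (path_event t m).
Proof.
have mX u : measurable (X u @^-1` B).
  by apply: (traj_sigmaF XU u).2; exact: traj_state XU u _ mB.
elim: m t => [|m IH] t; first by rewrite path_event0.
rewrite path_eventS; apply: measurableI => //; apply: measurableI => //.
by apply: (traj_sigmaF XU t).2.
Qed.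

Let K := step_giry M pi.
Let mK : measurable_fun setT K. Proof. exact: measurable_step_giry. Qed.

Let mX t : measurable_fun setT (X t).
Proof. exact (adapted_measurable (traj_sigmaF XU t) (traj_state XU t)). Qed.

Let path_probability0 t E : measurable E ->
  P (E `&` path_event t 0) = \int[P]_(w in E) stay K B 0 (X t w).
Proof.
move=> mE; have mXB : measurable (X t @^-1` B).
  by rewrite -(setTI (_ @^-1` _)); exact: mX.
by rewrite path_event0 setIC -integral_indic.
Qed.

Let integral_stayS t m E : measurable E ->
  \int[P]_(w in E `&` X t @^-1` B) giry_int (K (X t w)) (stay K B m) =
  \int[P]_(w in E) stay K B m.+1 (X t w).
Proof.
move=> mE; rewrite integral_mkcondr; apply: eq_integral => w _.
have XB : (w \in X t @^-1` B) = (X t w \in B) by apply/idP/idP; rewrite !inE.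
by rewrite patchE /= indicE XB; case: ifPn => _; rewrite ?mul1e ?mul0e.
Qed.

(** Induction on [m] for all [t] and [E]: the first step enlarges the conditioning to [E], [X t] in
    [B] and [N t], an event of [F t.+1] to which the induction hypothesis applies. On it the action
    follows [pi], so the Markov property brings the integral back to time [t]. *)
Lemma path_probability_le t m E : F t E ->
  P (E `&` path_event t m) <= \int[P]_(w in E) stay K B m (X t w).
Proof.
elim: m t E => [|m IH] t E FE.
  by rewrite path_probability0//; exact ((traj_sigmaF XU t).2 _ FE).
have sF := traj_sigmaF XU t.
have FXB : F t (X t @^-1` B) by exact: traj_state XU t _ mB.
have FE1 := sub_sigma_algebraI sF FE FXB.
have FE2 := sub_sigma_algebraI sF FE1 (FN t).
have FE2S := traj_Fa_F XU (traj_F_Fa XU FE2).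
have mE1 := sF.2 _ FE1.
have mE2 := sF.2 _ FE2.
rewrite path_eventS 2!setIA; apply: (le_trans (IH _ _ FE2S)).
rewrite (trajectory_step_integral XU FE2 (pi := pi)); last 3 first.
- by move=> w [_ /polN].
- exact: measurable_stay.
- exact: stay_ge0.
rewrite -integral_stayS; last exact (sF.2 _ FE).
(* The only loss in each step: [N t] is dropped from the domain of integration of a nonnegative
   function. *)
apply: ge0_subset_integral => //.
- have mi := measurable_giry_int (measurable_stay mK mB m)
    (@stay_ge0 _ _ _ K B m).
  exact (measurable_funTS (measurableT_comp (measurableT_comp mi mK) (mX t))).
- by move=> w _; apply: integral_ge0 => s _; exact: stay_ge0.
Qed.

(** The same induction, where no event is dropped and equality survives. *)
Lemma path_probability t m E : (forall u, N u = setT) -> F t E ->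
  P (E `&` path_event t m) = \int[P]_(w in E) stay K B m (X t w).
Proof.
move=> NT; elim: m t E => [|m IH] t E FE.
  by rewrite path_probability0//; exact ((traj_sigmaF XU t).2 _ FE).
have sF := traj_sigmaF XU t.
have FXB : F t (X t @^-1` B) by exact: traj_state XU t _ mB.
have FE1 := sub_sigma_algebraI sF FE FXB.
have FE1S := traj_Fa_F XU (traj_F_Fa XU FE1).
rewrite path_eventS NT setIT setIA IH//.
rewrite (trajectory_step_integral XU FE1 (pi := pi)).
- by rewrite integral_stayS//; exact (sF.2 _ FE).
- by move=> w _; apply: polN; rewrite NT.
- exact: measurable_stay.
- exact: stay_ge0.
Qed.

End path_probability.

(** * Distance to the goal *)

Section goal_distance.
Context (R : realType) (S : completeNormedModType R) (G : set S).
Hypothesis G0 : G !=set0.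

Let dist_has_inf s : has_inf [set `|s - g| | g in G].
Proof.
split; first by have [g Gg] := G0; exists `|s - g|; exists g.
by exists 0 => _ [g _ <-].
Qed.

Lemma goal_dist_ge0 s : 0 <= goal_dist G s.
Proof. by apply: lb_le_inf => [|_ [g _ <-]//]; exact: (dist_has_inf s).1. Qed.

Lemma goal_dist_ltP s r :
  goal_dist G s < r <-> exists2 g, G g & `|s - g| < r.
Proof.
split=> [/(inf_lt (dist_has_inf s).1)[_ [g Gg <-] gr]|[g Gg]].
  by exists g.
by apply: le_lt_trans; apply: (ge_inf (dist_has_inf s).2); exists g.
Qed.

(** The set is the union of the balls of radius [r] about the points of [G]. *)
Lemma open_goal_dist_lt r : open [set s | goal_dist G s < r].
Proof.
rewrite (_ : [set s | _] = \bigcup_(g in G) ball g r); last first.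
  apply/seteqP; split => s /=.
    move=> /goal_dist_ltP[g Gg sg]; exists g => //.
    by rewrite -ball_normE /ball_/= distrC.
  move=> [g Gg]; rewrite -ball_normE /ball_/= distrC => sg.
  by apply/goal_dist_ltP; exists g.
by apply: bigcup_open => g _; exact: ball_open.
Qed.

Lemma measurable_goal_dist_ge r :
  measurable ([set s | r <= goal_dist G s] : set (borel S)).
Proof.
rewrite (_ : [set s | _] = ~` [set s | goal_dist G s < r]).
  apply: measurableC; apply: sub_sigma_algebra; exact: open_goal_dist_lt.
by apply/seteqP; split => s /=; rewrite leNgt => /negP.
Qed.

(** The lower limit is the supremum of the tail infima, all nonnegative, so it is nonzero exactly
    when some tail infimum is positive. One index [j] can serve as both starting time and threshold
    because increasing it weakens both conditions. *)
Lemma goal_missedP (x : nat -> S) : ~ goal_reached G x <->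
  exists j, forall t, (j <= t)%N -> j.+1%:R^-1 <= goal_dist G (x t).
Proof.
pose u t := (goal_dist G (x t))%:E.
have supE : limn_einf u = ereal_sup (range (einfs u)).
  by rewrite limn_einf_lim; apply/cvg_lim => //; exact: cvg_einfs_sup.
rewrite /goal_reached -/u supE; split => [|[j xj] sup0]; last first.
  have : (j.+1%:R^-1%:E <= ereal_sup (range (einfs u)))%E.
    apply: le_trans (ereal_sup_ubound _); last by exists j.
    by apply: le_ereal_inf_tmp => _ [t /= jt <-]; rewrite lee_fin xj.
  by rewrite sup0 lee_fin leNgt invr_gt0 ltr0Sn.
apply: contra_notP => /forallNP noj; apply/eqP.
rewrite eq_le; apply/andP; split.
  apply: ge_ereal_sup => _ [n _ <-]; apply/lee_addgt0Pr => e e0; rewrite add0e.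
  (* At least [n], so that a time after [j] lies in the tail from [n]; at least the integer part of
     [e^-1], so that [1/(j+1)] is at most [e]. *)
  pose j := maxn n (Num.truncn e^-1).
  have /existsNP[t /not_implyP[jt /negP]] := noj j.
  rewrite -ltNge => xt.
  apply: (@le_trans _ _ (u t)).
    apply: ereal_inf_lbound; exists t => //=.
    by rewrite (leq_trans _ jt)// leq_maxl.
  rewrite lee_fin (le_trans (ltW xt))// -[leRHS]invrK.
  rewrite lef_pV2 ?posrE ?invr_gt0//.
  by rewrite (le_trans (ltW (truncnS_gt _)))// ler_nat ltnS leq_maxr.
apply: (@le_trans _ _ (einfs u 0%N)).
  by apply: le_ereal_inf_tmp => _ [t _ <-]; rewrite lee_fin goal_dist_ge0.
by apply: ereal_sup_ubound; exists 0%N.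
Qed.

End goal_distance.

(** An inequality only, since [a] may exceed 1: the density is 1 on the unit interval, and the
    Lebesgue measure of [[0, a]] bounds the integral. *)
Lemma uniform_prob_lt (R : realType) (a : R) : 0 <= a ->
  (uniform_prob (@ltr01 R) [set x : R | (x < a)%R] <= a%:E)%E.
Proof.
move=> a0.
have -> : [set x : R | x < a] = `]-oo, a[%classic.
  by apply/seteqP; split => x; rewrite /= in_itv.
rewrite /uniform_prob integral_uniform_pdf.
rewrite (eq_integral (cst 1%E)); last first.
  move=> x; rewrite inE /= => -[_]; rewrite in_itv /= /uniform_pdf => ->.
  by rewrite subr0 invr1.
rewrite integral_cst//= ?mul1e; last exact: measurableI.
apply: (@le_trans _ _ (lebesgue_measure `[0, a]%classic)).
  apply: le_measure; rewrite ?inE//; first exact: measurableI.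
  by move=> x [] /=; rewrite !in_itv/= => /ltW -> /andP[-> _].
rewrite lebesgue_measure_itv/= lte_fin; case: ifPn => _.
  by rewrite oppr0 addr0.
by rewrite lee_fin.
Qed.

(** * Finiteness of the critic updates *)

Section finitely_many_updates.
Context d (Omega : measurableType d) (R : realType)
  (S : completeNormedModType R) (A : ptopologicalType) (W : topologicalType)
  (D : agent Omega S A W) (o : Omega) (x : nat -> S) (wstar : nat -> option W)
  (wdag : nat -> W) (sdag : nat -> S).
Hypothesis env0 : critic_envelope D (wdag 0%N) (sdag 0%N).
Hypothesis step : forall t, critic_step D t o (x t.+1) (wstar t.+1)
  (wdag t) (sdag t) (wdag t.+1) (sdag t.+1).

Let c t := critic D (wdag t) (sdag t).

(** A stored weight satisfies the envelope at its stored state, first by [env0] and then by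
    feasibility of the update; [kappa_low] is nonnegative at norms, being zero at zero and
    monotone. *)
Let c_le0 t : c t <= 0.
Proof.
have env w s : critic_envelope D w s -> critic D w s <= 0.
  move=> /andP[_ /le_trans]; apply; rewrite oppr_le0.
  by have [k0 klow _] := kappa_lowP D; rewrite -k0; exact: klow.
elim: t => [|t IH]; first exact: env.
have := step t; rewrite /critic_step /c.
case: (wstar t.+1) => [w [[[_ _ we] _] -> ->]|[-> ->]//]; exact: env.
Qed.

Let c_step t : c t + (if isSome (wstar t.+1) then nu_bar D else 0) <= c t.+1.
Proof.
have := step t; rewrite /critic_step /c.
case: (wstar t.+1) => [w [[[_ wn _] _] -> ->]|[-> ->]] /=.
  by rewrite addrC -lerBrDr.
by rewrite addr0.
Qed.

Let c_nd t s : (t <= s)%N -> c t <= c s.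
Proof.
move=> /subnKC <-; elim: (s - t)%N => [|k IH]; first by rewrite addn0.
rewrite addnS (le_trans IH)// (le_trans _ (c_step _))// lerDl.
by case: ifP => // _; exact/ltW/nu_bar_gt0.
Qed.

Lemma critic_updates_stop :
  exists n, forall t, (n <= t)%N -> wstar t.+1 = None.
Proof.
apply: contrapT => /forallNP often.
have growth k : exists t, c 0%N + nu_bar D *+ k <= c t.
  elim: k => [|k [n nk]]; first by exists 0%N; rewrite mulr0n addr0.
  have /existsNP[t /not_implyP[nt wt]] := often n.
  exists t.+1; apply: le_trans (c_step t).
  have -> : isSome (wstar t.+1) by case: (wstar t.+1) wt.
  by rewrite mulrSr addrA lerD2r (le_trans nk)// c_nd.
(* The number of updates after which [c 0] plus that many [nu_bar] is positive, contradicting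
   [c_le0]. *)
have [t] := growth (Num.truncn (- c 0%N / nu_bar D)).+1.
apply/negP; rewrite -ltNge (le_lt_trans (c_le0 t))// -ltrBlDl sub0r.
by rewrite -mulr_natl -ltr_pdivrMr ?nu_bar_gt0// truncnS_gt.
Qed.

End finitely_many_updates.

(** The partial sums are at most [z / (1 - z)]; the exponent [n.+1] matches [P_relax] during
    iteration [n.+1]. *)
Lemma geometric_eseries_lty (R : realType) (z : R) : 0 <= z < 1 ->
  (\sum_(n <oo) (z ^+ n.+1)%:E < +oo)%E.
Proof.
move=> /andP[z0 z1]; apply: (@le_lt_trans _ _ (z / (1 - z))%:E);
  last exact: ltry.
apply: lime_le.
  by apply: is_cvg_nneseries => n _ _; rewrite lee_fin exprn_ge0.
apply: nearW => n; rewrite sumEFin lee_fin.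
have -> : \sum_(0 <= i < n) z ^+ i.+1 = series (geometric z z) n.
  by rewrite /series /=; apply: eq_bigr => i _; rewrite exprS.
rewrite geometric_seriesE ?lt_eqF//.
apply: ler_wpM2r; first by rewrite invr_ge0 subr_ge0 ltW.
by rewrite ler_piMr// lerBlDr lerDl exprn_ge0.
Qed.

(** * The event of missing the goal *)

Section missed.
Context (R : realType) (S : completeNormedModType R) (G : set S).
Hypothesis G0 : G !=set0.

Definition far (j : nat) : set (borel S) :=
  [set s | j.+1%:R^-1 <= goal_dist G s].

Lemma measurable_far j : measurable (far j).
Proof. exact: measurable_goal_dist_ge. Qed.

(** By [goal_missedP] the complement is a countable union of countable intersections of events about
    single states. *)
Lemma measurable_goal_reached d (Omega : measurableType d)
    (X : nat -> Omega -> borel S) : (forall t, measurable_fun setT (X t)) ->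
  measurable [set w | goal_reached G (fun t => X t w)].
Proof.
move=> mX.
have -> : [set w | goal_reached G (fun t => X t w)] =
    ~` \bigcup_j \bigcap_(t in [set t | (j <= t)%N]) (X t @^-1` far j).
  apply/seteqP; split => w /=.
    by move=> gw [j _ jw]; apply/goal_missedP : gw => //; exists j.
  move=> nw; apply: contrapT => /goal_missedP-/(_ G0)[j jw].
  by apply: nw; exists j.
apply: measurableC; apply: bigcup_measurable => j _.
apply: bigcap_measurable => [|t _]; first by exists j => /=.
rewrite -(setTI (_ @^-1` _)); apply: mX => //; exact: measurable_far.
Qed.

End missed.

(** * From finite horizons to the whole trajectory *)

Section stay_limit.
Context d (Omega : measurableType d) (R : realType) (P : probability Omega R)
  (S : completeNormedModType R) (A : ptopologicalType) (M : mdp S A)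
  (pi : policy S A).
Local Open Scope ereal_scope.

(** [stay] is the probability that the given trajectory remains in [B] up to time [m], by
    [path_probability] with [N] the whole space; continuity from above gives the limit. This turns
    the hypothesis on [pi0], which concerns particular trajectories, into one on the kernel. *)
Lemma stay_cvg s0 (X : nat -> Omega -> borel S) (B : set (borel S)) :
  measurable B -> trajectory P M pi s0 X ->
  stay (step_giry M pi) B m s0 @[m --> \oo] -->
  P (\bigcap_t (X t @^-1` B)).
Proof.
move=> mB [U [F [Fa XU]]].
have mXB t : measurable (X t @^-1` B).
  by apply: (traj_sigmaF XU t).2; exact: traj_state XU t _ mB.
pose N (_ : nat) := [set: Omega].
have FN t : F t (N t) by exact: sub_sigma_algebraT (traj_sigmaF XU t).
have -> : stay (step_giry M pi) B ^~ s0 = fun m => P (path_event X N B 0 m).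
  apply/funext => m.
  have := path_probability (N := N) XU (pi := pi) (fun _ _ _ _ _ => erefl) mB m
    (fun=> erefl) (FN 0%N).
  rewrite setTI => ->.
  under eq_integral do rewrite (traj_init XU).
  rewrite -[N 0%N]/[set: Omega] integral_cst// [X in _ * X](_ : _ = 1) ?mule1//.
  exact: probability_setT.
have -> : \bigcap_t (X t @^-1` B) = \bigcap_m path_event X N B 0 m.
  apply/seteqP; split => w wB t _; first by split => // i _; exact: wB.
  by have [/(_ t (leqnn t))] := wB t Logic.I.
have mp m : measurable (path_event X N B 0 m).
  exact (measurable_path_event XU FN mB 0%N m).
apply: nonincreasing_cvg_mu => //.
- exact: le_lt_trans (probability_le1 P (mp 0%N)) (ltry _).
- exact: bigcapT_measurable.
- move=> m n mn; apply/subsetPset => w [wB _]; split => // i im.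
  by apply: wB; exact: leq_trans mn.
Qed.

End stay_limit.

Section missed_probability.
Context d (Omega : measurableType d) (R : realType) (P : probability Omega R)
  (S : completeNormedModType R) (G : set S) (eta : R).
Hypothesis G0 : G !=set0.
Variable X : nat -> Omega -> borel S.
Hypothesis mX : forall t, measurable_fun setT (X t).
Local Open Scope ereal_scope.

Let goal := [set w | goal_reached G (fun t => X t w)].

Lemma goal_reaching_missed :
  goal_reaching P G eta X <-> P (~` goal) <= eta%:E.
Proof.
have mg : measurable goal by exact: measurable_goal_reached.
rewrite probability_setC// /goal_reaching -/goal.
have fP : P goal \is a fin_num by exact: fin_num_measure.
by rewrite -(fineK fP) -EFinB !lee_fin !lerBlDr addrC.
Qed.

End missed_probability.

(** * Trajectories that eventually follow the base policy *)

Section eventually_base_policy.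
Context d (Omega : measurableType d) (R : realType) (P : probability Omega R)
  (S : completeNormedModType R) (A : ptopologicalType) (M : mdp S A)
  (G : set S) (eta : R) (pi : policy S A)
  (X0 : S -> nat -> Omega -> borel S).
Hypothesis G0 : G !=set0.
Hypothesis X0P : forall s, trajectory P M pi s (X0 s).
Hypothesis reachX0 : forall s, goal_reaching P G eta (X0 s).
Context (pol : nat -> Omega -> policy S A) (s0 : S)
  (X : nat -> Omega -> borel S) (U : nat -> Omega -> borel A)
  (F Fa : nat -> set (set Omega)).
Hypothesis XU : controlled_trajectory P M pol s0 X U F Fa.
Variable N : nat -> set Omega.
Hypothesis FN : forall t, F t (N t).
Hypothesis polN : forall t w, N t w -> forall B, measurable B ->
  pol t w (X t w) B = pi (X t w) B.
Local Open Scope ereal_scope.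

Let mX t : measurable_fun setT (X t).
Proof. exact (adapted_measurable (traj_sigmaF XU t) (traj_state XU t)). Qed.

(** The event [D_j] of the overview, with [N t] abstracting the condition under which the action at
    time [t] follows [pi]. *)
Let missed j := \bigcap_(t in [set t | (j <= t)%N]) (X t @^-1` far G j `&` N t).

Let mmissed j : measurable (missed j).
Proof.
apply: bigcap_measurable => [|t _]; first by exists j => /=.
apply: measurableI; last exact ((traj_sigmaF XU t).2 _ (FN t)).
by rewrite -(setTI (_ @^-1` _)); apply: mX => //; exact: measurable_far.
Qed.

(** For each [m] the event is contained in a path event from time [j], so [stay] evaluated at [X j]
    bounds it in mean; then [m] tends to infinity under dominated convergence. *)
Let missed_le j : P (missed j) <= eta%:E.
Proof.
have mB := measurable_far G0 j.
pose K := step_giry M pi.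
pose L s := P (\bigcap_t (X0 s t @^-1` far G j)).
have L_le s : L s <= eta%:E.
  have [V [F0 [Fa0 XV]]] := X0P s.
  have mX0 t : measurable_fun setT (X0 s t).
    exact (adapted_measurable (traj_sigmaF XV t) (traj_state XV t)).
  have /(goal_reaching_missed P eta G0 mX0) := reachX0 s.
  apply: le_trans; apply: le_measure; rewrite ?inE.
  - apply: bigcapT_measurable => t.
    by rewrite -(setTI (_ @^-1` _)); exact: mX0.
  - by apply: measurableC; exact: measurable_goal_reached.
  - by move=> w wB /=; apply/goal_missedP => //; exists j => t _; exact: wB.
have stayL s : stay K (far G j) m s @[m --> \oo] --> L s by exact: stay_cvg.
have mstay m : measurable_fun setT (fun w => stay K (far G j) m (X j w)).
  exact (measurableT_comp (measurable_stay (measurable_step_giry M pi) mB m)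
    (mX j)).
have stay_ub m : P (missed j) <= \int[P]_w stay K (far G j) m (X j w).
  apply: le_trans (path_probability_le XU FN polN mB m
    (sub_sigma_algebraT (traj_sigmaF XU j))).
  rewrite setTI; apply: le_measure; rewrite ?inE//.
    exact (measurable_path_event XU FN mB j m).
  by move=> w jw; split => i _; have [] := jw (j + i)%N (leq_addr _ _).
(* The family [X0 s] is not assumed measurable in [s]; measurability of [L] along [X j] comes from
   its being a pointwise limit of [stay]. *)
have mL : measurable_fun setT (fun w => L (X j w)).
  by apply: (emeasurable_fun_cvg _ _ mstay) => w _; exact: stayL.
have intL : \int[P]_w stay K (far G j) m (X j w) @[m --> \oo] -->
    \int[P]_w L (X j w).
  apply: (@dominated_cvg _ _ _ P setT measurableT _ _ (cst 1)) => //.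
  - exact: finite_measure_integrable_cst.
  - move=> m w _; rewrite gee0_abs ?stay_ge0//.
    by apply: stay_le1 => //; exact: measurable_step_giry.
apply: (@le_trans _ _ (\int[P]_w L (X j w))).
  rewrite -(cvg_lim _ intL)//; apply: lime_ge.
    by apply/cvg_ex; exists (\int[P]_w L (X j w)).
  exact: nearW.
apply: (@le_trans _ _ (\int[P]_w eta%:E)).
  by apply: ge0_le_integral => //.
rewrite integral_cst// [X in _ * X](_ : _ = 1) ?mule1//.
exact: probability_setT.
Qed.

Lemma goal_reaching_eventually :
  P (lim_sup_set (fun t => ~` N t)) = 0 -> goal_reaching P G eta X.
Proof.
move=> PN; apply/(goal_reaching_missed P eta G0 mX).
have mN t : measurable (~` N t).
  by apply: measurableC; exact ((traj_sigmaF XU t).2 _ (FN t)).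
have mls : measurable (lim_sup_set (fun t => ~` N t)).
  by apply: bigcapT_measurable => n; exact: bigcup_measurable.
have mU : measurable (\bigcup_j missed j) by exact: bigcupT_measurable.
have nd : nondecreasing_seq missed.
  move=> i j ij; apply/subsetPset => w iw t /= jt.
  have [it Nt] := iw t (leq_trans ij jt); split => //.
  by rewrite /far /= (le_trans _ it)// lef_pV2 ?posrE// ler_nat ltnS.
have PU : P (\bigcup_j missed j) <= eta%:E.
  have cU := nondecreasing_cvg_mu (mu := P) mmissed mU nd.
  rewrite -(cvg_lim _ cU)//; apply: lime_le;
    last by apply: nearW; exact: missed_le.
  by apply/cvg_ex; exists (P (\bigcup_j missed j)).
apply: (@le_trans _ _
    (P (\bigcup_j missed j `|` lim_sup_set (fun t => ~` N t)))).
  apply: le_measure; rewrite ?inE.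
  - by apply: measurableC; exact: measurable_goal_reached.
  - exact: measurableU.
  move=> w /goal_missedP-/(_ G0)[j jw].
  have [ls|/existsNP[n /not_implyP[_ nls]]] :=
    pselect (lim_sup_set (fun t => ~` N t) w); [by right|left].
  (* After [n] every [N t] holds, and after [j] the distance is at least [1/(j+1)], hence at least
     the smaller threshold for the maximum. *)
  exists (maxn j n) => // t /=; rewrite geq_max => /andP[jt nt]; split.
    rewrite /far /= (le_trans _ (jw t jt))// lef_pV2 ?posrE// ler_nat ltnS.
    exact: leq_maxl.
  by apply: contrapT => Nt; apply: nls; exists t.
by apply: le_trans (measureU2 _ mU mls) _; rewrite [X in _ + X]PN adde0.
Qed.

End eventually_base_policy.

(** * Application to the algorithm *)

Unset Implicit Arguments.

Theorem theorem1
  (R : realType)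
  (d : measure_display) (Omega : measurableType d) (P : probability Omega R)
  (S : completeNormedModType R) (hS : finite_dimensional S)
  (A : ptopologicalType) (hA : compact [set: A])
  (M : mdp S A)
  (Pi : set (policy S A))
  (gamma : R) (hgamma : 0 < gamma <= 1)
  (G : set S) (hGc : compact G) (hG0 : nbhs (0 : S) G)
  (eta : R) (heta : 0 <= eta < 1)
  (pi0 : policy S A)
  (X0 : S -> nat -> Omega -> borel S)
  (hX0 : forall s0, trajectory P M pi0 s0 (X0 s0))
  (hpi0 : forall s0, goal_reaching P G eta (X0 s0))
  (W : topologicalType) (D : agent Omega S A W) :
  forall (s0 : S) (w0 : W) (X : nat -> Omega -> borel S),
    algorithm_run P M Pi pi0 D s0 w0 X ->
    goal_reaching P G eta X.
Proof.
move=> s0 w0 X.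
move=> [pol [U [F [Fa [Fc [wstar [wdag [sdag [q [XU [[_ env0 init] run]]]]]]]]]]].
have G0 : G !=set0 by exists 0; exact: nbhs_singleton.
pose lambda := lambda_relax D.
have /andP[l0 l1] := lambda_relax_itv D.
pose relax t := q t.+1 @^-1` [set x | x < lambda ^+ t.+1].
pose found t := [set o | isSome (wstar t.+1 o)].
have mlt (a : R) : measurable [set x : R | x < a].
  have -> : [set x : R | x < a] = `]-oo, a[%classic.
    by apply/seteqP; split => x; rewrite /= in_itv.
  exact: measurable_itv.
(* At time 0 the policy is [pi0] by initialization; at time [t.+1] it acts as [pi0] if iteration
   [t.+1] neither updates nor relaxes. The indices of [found] and [relax] are therefore shifted by
   one. *)
pose N t : set Omega :=
  if t is t'.+1 then ~` found t' `&` ~` relax t' else setT.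
have Frelax t : F t.+1 (relax t).
  by have [_ [[_ _ aq _] _]] := run t; exact: aq.
have Ffound t : F t.+1 (found t).
  by have [[_ _ FcF] [[_ Fcf _ _] _]] := run t; exact: FcF.
have FN t : F t (N t).
  case: t => [|t]; first exact: sub_sigma_algebraT (traj_sigmaF XU 0%N).
  have sF := traj_sigmaF XU t.+1.
  by apply: sub_sigma_algebraI => //; apply: sub_sigma_algebraC.
apply: (goal_reaching_eventually G0 hX0 hpi0 XU FN).
  move=> [|t] w; first by move=> _ B _; have [_ _ ->] := init w.
  move=> [nf nr] B mB; have [_ [_ /(_ w)[_]]] := run t.
  rewrite /actor_step; case: ifPn => [/orP[//|//]|_]; exact.
have mrelax t : measurable (relax t).
  exact ((traj_sigmaF XU t.+1).2 _ (Frelax t)).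
apply/eqP; rewrite eq_le measure_ge0 andbT.
(* First Borel-Cantelli lemma. Taking [setT] as conditioning event makes the conditional law of
   [q t.+1] its plain law, so each probability is at most [lambda ^+ t.+1]. *)
have relax0 : P (lim_sup_set relax) = 0%E.
  apply: lim_sup_set_cvg0 => //.
  apply: le_lt_trans (geometric_eseries_lty (lambda_relax_itv D)).
  apply: lee_nneseries => // t _.
  have [[sFc _ _] [[_ _ _ uq] _]] := run t.
  have := uq setT _ (sub_sigma_algebraT sFc) (mlt (lambda ^+ t.+1)).
  rewrite setTI -/(relax t) => qE; rewrite [leLHS]qE.
  rewrite integral_cst// [X in (_ * X)%E](_ : _ = 1%E) ?mule1.
    exact: uniform_prob_lt (exprn_ge0 _ l0).
  exact: probability_setT.
rewrite -relax0; apply: le_measure; rewrite ?inE.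
- apply: bigcapT_measurable => n; apply: bigcup_measurable => t _.
  by apply: measurableC; exact ((traj_sigmaF XU t).2 _ (FN t)).
- by apply: bigcapT_measurable => n; exact: bigcup_measurable.
(* Pathwise: the updates of [w] stop after some [m], so each later failure of [N] must be a
   relaxation. *)
move=> w often n _.
have [m noup] : exists m, forall t, (m <= t)%N -> wstar t.+1 w = None.
  apply: (@critic_updates_stop _ _ _ _ _ _ D w (X^~ w) (wstar^~ w) (wdag^~ w)
    (sdag^~ w)).
  - by have [-> -> _] := init w.
  - by move=> t; have [_ [_ /(_ w)[]]] := run t.
have [[|t] /= mt Nt] := often (maxn m n).+1 I; first by [].
move: mt; rewrite ltnS geq_max => /andP[mt nt].
exists t => //; apply: contrapT => rt; apply: Nt; split => //.
by rewrite /found /= noup.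
Qed.
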